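(* Let $d\in\mathbb{N}$, and let $\mathcal{M}^{+}$ denote the space of all real symmetric, positive semidefinite, $d\times d$ matrices. For every real symmetric $d\times d$ matrix $H$, with canonical decomposition $H=H^{+}-H^{-}$, we have \[ \inf_{M\in \mathcal{M}^{+}}\Vert H-M\Vert_{*}=\Vert H^{-}\Vert_{*}. \] Consequently, the following quantities \[ \mathrm{LOPS}(H)=\Vert H^{-}\Vert_{*},\qquad \mathrm{NLOPS}(H)=\frac{\Vert H^{-}\Vert_{*}}{\Vert H\Vert_{*}},\qquad \mathrm{PS}(H)=\frac{\Vert H^{+}\Vert_{*}}{\Vert H\Vert_{*}} \] define, respectively, the index of lack of positive semidefiniteness (LOPS) of $H$, its normalized version (NLOPS), and the index of positive semidefiniteness (PS) of $H$.
   Context: For a real symmetric $d\times d$ matrix $A$ with eigenvalues $\lambda_1(A),\dots,\lambda_d(A)$ (counted with multiplicity), the nuclear (trace) norm is $\Vert A\Vert_{*}=\sum_{i=1}^d|\lambda_i(A)|$. Canonical decomposition: write a real symmetric $d\times d$ matrix $H$ as $H=Q\Lambda Q^{\top}$ with $Q$ orthogonal and $\Lambda=\mathrm{diag}(\lambda_1,\dots,\lambda_d)$, where $\lambda_1,\dots,\lambda_d$ are the eigenvalues of $H$. Put $\lambda_i^{+}=\max\{\lambda_i,0\}$, $\lambda_i^{-}=\max\{-\lambda_i,0\}$, $\Lambda^{\pm}=\mathrm{diag}(\lambda_1^{\pm},\dots,\lambda_d^{\pm})$, and $H^{\pm}=Q\Lambda^{\pm}Q^{\top}$. Then $H=H^{+}-H^{-}$,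 with $H^{+}$ and $H^{-}$ symmetric and positive semidefinite, and $\Vert H\Vert_{*}=\Vert H^{+}\Vert_{*}+\Vert H^{-}\Vert_{*}$. *)

(* Defs.v *)
From HB Require Import structures.
From mathcomp Require Import all_boot all_order all_algebra.
From mathcomp Require Import all_classical all_reals.
From mathcomp Require Import polyrcf complex ring.

Set Implicit Arguments.
Unset Strict Implicit.
Unset Printing Implicit Defensive.

Import Order.TTheory GRing.Theory Num.Theory.
Local Open Scope ring_scope.
Local Open Scope classical_set_scope.

(* The real eigenvalues, repeated according to their multiplicity as roots of
   the characteristic polynomial; when A is symmetric this lists all d
   eigenvalues of A (see perm_eigenvalues and symmetric_diagonalization). *)
Definition eigenvalues (R : realType) (d : nat) (A : 'M[R]_d) : seq R :=
  flatten [seq nseq (mup x (char_poly A)) x | x <- rootsR (char_poly A)].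

Definition nuclear_norm (R : realType) (d : nat) (A : 'M[R]_d) : R :=
  \sum_(x <- eigenvalues A) `|x|.

Definition psd_matrices (R : realType) (d : nat) : set 'M[R]_d :=
  [set M | M \is symmetricmx /\
           forall v : 'cV[R]_d, 0 <= (v^T *m M *m v) 0 0].

Definition canonical_decomposition (R : realType) (d : nat)
    (H Hp Hm : 'M[R]_d) : Prop :=
  exists (Q : 'M[R]_d) (l : 'rV[R]_d),
    [/\ Q *m Q^T = 1%:M,
        H = Q *m diag_mx l *m Q^T,
        Hp = Q *m diag_mx (\row_i Num.max (l 0 i) 0) *m Q^T &
        Hm = Q *m diag_mx (\row_i Num.max (- l 0 i) 0) *m Q^T].

(* The default value (0, 0) is only taken when H has no canonical
   decomposition, which never happens for a symmetric H
   (canonical_decomposition_exists). *)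
Definition canonical_parts (R : realType) (d : nat) (H : 'M[R]_d) :
    'M[R]_d * 'M[R]_d :=
  xget (0, 0) [set P | canonical_decomposition H P.1 P.2].

Definition positive_part (R : realType) (d : nat) (H : 'M[R]_d) : 'M[R]_d :=
  (canonical_parts H).1.

Definition negative_part (R : realType) (d : nat) (H : 'M[R]_d) : 'M[R]_d :=
  (canonical_parts H).2.

Definition LOPS (R : realType) (d : nat) (H : 'M[R]_d) : R :=
  nuclear_norm (negative_part H).

Definition NLOPS (R : realType) (d : nat) (H : 'M[R]_d) : R :=
  nuclear_norm (negative_part H) / nuclear_norm H.

Definition PS (R : realType) (d : nat) (H : 'M[R]_d) : R :=
  nuclear_norm (positive_part H) / nuclear_norm H.

Lemma symmetricmxE (R : realType) (d : nat) (A : 'M[R]_d) :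
  (A \is symmetricmx) = (A^T == A).
Proof.
rewrite qualifE expr0 scale1r /= eq_sym.
by congr (_ == _); apply/matrixP => i j; rewrite !mxE.
Qed.

Lemma perm_eigenvalues (R : realType) (d : nat) (Q : 'M[R]_d) (l : 'rV[R]_d) :
  Q *m Q^T = 1%:M ->
  perm_eq (eigenvalues (Q *m diag_mx l *m Q^T)) [seq l 0 i | i <- enum 'I_d].
Proof.
move=> QQ; set A := Q *m _ *m _; pose s := [seq l 0 i | i <- enum 'I_d].
have QtQ : Q^T *m Q = 1%:M by apply: mulmx1C.
have pE : char_poly A = \prod_(x <- s) ('X - x%:P).
  have -> : char_poly A = char_poly (diag_mx l).
    rewrite /char_poly.
    have -> : char_poly_mx A =
        map_mx polyC Q *m char_poly_mx (diag_mx l) *m map_mx polyC Q^T.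
      rewrite /char_poly_mx mulmxBr mulmxBl -!map_mxM /= -/A; congr (_ - _).
      by rewrite mul_mx_scalar -scalemxAl -map_mxM QQ map_mx1 scalemx1.
    rewrite !det_mulmx mulrAC -det_mulmx -map_mxM QQ map_mx1 det1 mul1r //.
  rewrite char_poly_trig ?diag_mx_is_trig // big_map big_enum /=.
  by apply: eq_bigr => i _; rewrite !mxE eqxx.
have p0 : char_poly A != 0 by rewrite monic_neq0 ?char_poly_monic.
apply/allP => x _ /=; apply/eqP; rewrite -/s.
rewrite /eigenvalues count_flatten -map_comp sumnE big_map.
have rR y : (y \in rootsR (char_poly A)) = root (char_poly A) y.
  by rewrite -roots_on_rootsR.
under eq_bigr do rewrite /= count_nseq.
have mE y : mup y (char_poly A) = count_mem y s by rewrite pE mu_prod_XsubC.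
have [xr|xNr] := boolP (x \in rootsR (char_poly A)).
  rewrite (bigD1_seq x) ?uniq_roots //= eqxx mul1n big1 ?addn0 //.
  by move=> y /negPf ->.
rewrite big_seq big1.
  by rewrite -mE mupNroot // -rR.
move=> y yr; case: (eqVneq y x) => [yx|/negPf yx]; last by rewrite /= yx.
by rewrite -yx yr in xNr.
Qed.

Lemma symmetric_eigenvalue (R : realType) (d : nat) (H : 'M[R]_d.+1) :
  H^T = H -> exists a, eigenvalue H a.
Proof.
move=> Hs; pose f := real_complex R; pose HC := map_mx f H.
have [a aE] := eigenvalue_closed HC (ltn0Sn d).
have [v Hv v0] := eigenvalueP aE.
pose w := (map_mx Num.conj v)^T.
have HCs : HC^T = HC by rewrite map_trmx Hs.
have HCr : map_mx Num.conj HC = HC.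
  by apply/matrixP => i j; rewrite !mxE; exact: conjc_real.
have Hw : HC *m w = a^* *: w.
  by rewrite -[HC in LHS]HCs -trmx_mul -HCr -map_mxM Hv map_mxZ linearZ.
have vw : a * (v *m w) 0 0 = a^* * (v *m w) 0 0.
  have : v *m HC *m w = v *m (HC *m w) by rewrite mulmxA.
  by rewrite Hv Hw -scalemxAl -scalemxAr => /matrixP/(_ 0 0); rewrite !mxE.
have vw0 : (v *m w) 0 0 != 0.
  apply: contraNneq v0 => e0; apply/eqP/rowP => i; rewrite mxE.
  move: e0; rewrite mxE => /eqP; rewrite psumr_eq0 => [|j _].
    move=> /allP/(_ i); rewrite mem_index_enum => /(_ isT) /=.
    by rewrite !mxE -normCK expf_eq0 normr_eq0 => /eqP.
  by rewrite !mxE -normCK exprn_ge0.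
have ar : a \is Num.real by apply/CrealP/esym; apply: (mulIf vw0).
exists (complex.Re a).
have fa : f (complex.Re a) = a by exact: RRe_real.
by move: aE; rewrite -fa eigenvalue_map.
Qed.

Lemma symmetric_diagonalization (R : realType) (d : nat) (H : 'M[R]_d) :
  H \is symmetricmx ->
  exists (Q : 'M[R]_d) (l : 'rV[R]_d),
    Q *m Q^T = 1%:M /\ H = Q *m diag_mx l *m Q^T.
Proof.
rewrite symmetricmxE => /eqP; elim: d H => [|d IH] H Hs.
  by exists 1%:M, 0; split; apply/matrixP => -[].
have [a /eigenvalueP[v0 Hv0 v0n]] := symmetric_eigenvalue Hs.
have dot_ge0 n (x : 'rV[R]_n) : 0 <= (x *m x^T) 0 0.
  by rewrite mxE sumr_ge0 // => i _; rewrite mxE -expr2 sqr_ge0.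
have dot_eq0 n (x : 'rV[R]_n) : (x *m x^T) 0 0 = 0 -> x = 0.
  rewrite mxE => /eqP; rewrite psumr_eq0 => [|i _].
    move=> /allP xP; apply/rowP => i; rewrite mxE.
    have /= := xP i; rewrite mem_index_enum mxE -expr2 sqrf_eq0 => /(_ isT).
    by move/eqP.
  by rewrite mxE -expr2 sqr_ge0.
pose c := Num.sqrt ((v0 *m v0^T) 0 0).
have c2 : c ^+ 2 = (v0 *m v0^T) 0 0 by rewrite sqr_sqrtr.
have c0 : c != 0.
  apply: contraNneq v0n => c0; apply/eqP/dot_eq0.
  by rewrite -c2 c0 expr0n.
pose v := c^-1 *: v0.
have Hv : v *m H = a *: v by rewrite -scalemxAl Hv0 !scalerA mulrC.
have vv : v *m v^T = 1%:M.
  rewrite linearZ /= -scalemxAl -scalemxAr scalerA [v0 *m _]mx11_scalar -c2.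
  by rewrite scale_scalar_mx -invfM -expr2 mulVf // sqrf_eq0.
(* Householder reflection exchanging v and e *)
have [P [PP Ps eP]] : exists P : 'M[R]_d.+1,
    [/\ P *m P^T = 1%:M, P^T = P & delta_mx 0 0 *m P = v].
  pose e : 'rV[R]_d.+1 := delta_mx 0 0.
  have ee : e *m e^T = 1%:M.
    apply/matrixP => i j; rewrite !ord1 mxE (bigD1 0) //= big1 => [|k kn].
      by rewrite !mxE !eqxx mulr1 addr0.
    by rewrite !mxE (negPf kn) mul0r.
  have [->|vne] := eqVneq v e.
    by exists 1%:M; rewrite trmx1 !mulmx1.
  have [w wE] : exists w, w = v - e by exists (v - e).
  pose n := (w *m w^T) 0 0.
  have n0 : n != 0.
    by apply: contra_neq vne => /dot_eq0/eqP; rewrite wE subr_eq0 => /eqP.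
  have wwT : w *m w^T = n%:M by rewrite [LHS]mx11_scalar.
  pose P := 1%:M - (2 / n) *: (w^T *m w).
  have Ps : P^T = P by rewrite linearB linearZ /= trmx1 trmx_mul trmxK.
  exists P; split => //.
    have WW : (w^T *m w) *m (w^T *m w) = n *: (w^T *m w).
      by rewrite mulmxA -(mulmxA w^T w) wwT mul_mx_scalar -scalemxAl.
    rewrite Ps /P mulmxBl !mulmxBr !mulmx1 mul1mx -!scalemxAl -!scalemxAr WW.
    move: (w^T *m w) => W; clear -n0; apply/matrixP => i j; rewrite !mxE.
    by field.
  rewrite mulmxBr mulmx1 -scalemxAr mulmxA -/e.
  have ew : (2 : R) *: (e *m w^T) = (- n)%:M.
    have vT : (v *m e^T)^T = v *m e^T by rewrite [v *m _]mx11_scalar tr_scalar_mx.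
    have ev : e *m v^T = v *m e^T by rewrite -[LHS]trmxK trmx_mul trmxK vT.
    rewrite raddfN /= -wwT wE linearB /= mulmxBr !mulmxBl !mulmxBr vv ee ev.
    by move: (v *m e^T) => X; apply/matrixP => i j; rewrite !mxE; ring.
  rewrite mulrC -scalerA scalemxAl ew mul_scalar_mx scalerA mulrN mulVf //.
  by rewrite scaleN1r opprK wE addrC subrK.
have [B0 B0E] : exists B0 : 'M_d.+1, B0 = P *m H *m P^T by eexists.
pose B : 'M_(1 + d) := B0.
have Bs : B^T = B by rewrite /B B0E !trmx_mul trmxK Hs mulmxA.
have Be : (delta_mx 0 0 : 'rV_d.+1) *m B0 = a *: delta_mx 0 0.
  rewrite B0E !mulmxA eP Hv -scalemxAl; congr (_ *: _).
  by rewrite -eP -mulmxA PP mulmx1.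
have B0j j : B0 0 j = a * (j == 0)%:R.
  by move/rowP: Be => /(_ j); rewrite -rowE !mxE eqxx.
have l0 : lshift d (0 : 'I_1) = (0 : 'I_d.+1) by apply: val_inj.
have Bul : ulsubmx B = a%:M.
  apply/matrixP => i j; rewrite !ord1 !mxE eqxx l0.
  by apply: etrans (B0j _) _; rewrite eqxx mulr1.
have Bur : ursubmx B = 0.
  apply/matrixP => i j; rewrite !ord1 !mxE l0.
  by apply: etrans (B0j _) _; rewrite mulr0.
have Bdl : dlsubmx B = 0 by rewrite -Bs -trmx_ursub Bur trmx0.
have /IH[Q [l [QQ BE]]] : (drsubmx B)^T = drsubmx B.
  by rewrite trmx_drsub Bs.
pose Q' : 'M[R]_(1 + d) := block_mx 1%:M 0 0 Q.
have QQ' : Q' *m Q'^T = 1%:M.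
  rewrite /Q' tr_block_mx !trmx0 trmx1 mulmx_block !mulmx0 !mul0mx mulmx1.
  by rewrite !addr0 add0r QQ -scalar_mx_block.
exists (P^T *m Q'), (row_mx a%:M l); split.
  rewrite trmx_mul trmxK mulmxA -(mulmxA _ Q') QQ' mulmx1.
  exact: mulmx1C.
have B_E : B = Q' *m diag_mx (row_mx a%:M l) *m Q'^T.
  rewrite diag_mx_row /Q' tr_block_mx !trmx0 trmx1 !mulmx_block.
  rewrite !mulmx0 !mul0mx !mulmx1 !mul1mx ?addr0 ?add0r ?mul0mx ?mulmx0.
  rewrite ?addr0 -BE -[LHS]submxK Bul Bur Bdl.
  by congr block_mx; apply/matrixP => i j; rewrite !ord1 !mxE eqxx.
rewrite trmx_mul trmxK mulmxA -(mulmxA _ Q') -(mulmxA P^T) -B_E /B B0E.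
have PP' : P^T *m P = 1%:M by apply: mulmx1C.
by rewrite -!mulmxA PP' mulmx1 mulmxA PP' mul1mx.
Qed.

Lemma canonical_decomposition_exists (R : realType) (d : nat) (H : 'M[R]_d) :
  H \is symmetricmx ->
  canonical_decomposition H (positive_part H) (negative_part H).
Proof.
move=> /symmetric_diagonalization[Q [l [QQ HE]]].
rewrite /positive_part /negative_part /canonical_parts.
case: xgetP => [P _ //|/(_ (_, _)) nP]; exfalso; apply: nP.
by exists Q, l; split.
Qed.

(* Main.v *)
Require Import Defs.
From HB Require Import structures.
From mathcomp Require Import all_boot all_order all_algebra.
From mathcomp Require Import all_classical all_reals.

Import Order.TTheory GRing.Theory Num.Theory.
Local Open Scope ring_scope.
Local Open Scope classical_set_scope.

(** In the eigenbasis Q of H, the diagonal entries of Q^T (H - M) Q are at most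
    the eigenvalues l_i of H, since those of Q^T M Q are nonnegative; hence their
    absolute values dominate the negative parts of the l_i.  On the other hand,
    the sum of the absolute values of the diagonal entries of a symmetric matrix
    in any orthonormal basis is at most its nuclear norm, because the squared
    entries of an orthogonal matrix are doubly stochastic.  The resulting lower
    bound is attained at M = H^+. *)

Section OrthogonalConjugation.
Set Implicit Arguments.
Unset Strict Implicit.
Variables (R : realType) (d : nat).
Implicit Types (A H Q : 'M[R]_d) (l : 'rV[R]_d).

Lemma sum_eigenvalues Q l (F : R -> R) : Q *m Q^T = 1%:M ->
  \sum_(x <- eigenvalues (Q *m diag_mx l *m Q^T)) F x = \sum_i F (l 0 i).
Proof.
by move=> QQ; rewrite (perm_big _ (perm_eigenvalues l QQ)) big_map big_enum.
Qed.

Lemma nuclear_norm_diag Q l : Q *m Q^T = 1%:M ->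
  nuclear_norm (Q *m diag_mx l *m Q^T) = \sum_i `|l 0 i|.
Proof. by move=> QQ; rewrite /nuclear_norm sum_eigenvalues. Qed.

(** [T] may be rectangular: the row [v^T *m Q] yields a quadratic form, the square [Q^T *m P] a
    diagonal entry in another basis. *)
Lemma diag_conjugation_entry n (T : 'M[R]_(n, d)) l i :
  (T *m diag_mx l *m T^T) i i = \sum_k l 0 k * T i k ^+ 2.
Proof.
rewrite mxE; apply: eq_bigr => k _.
by rewrite mul_mx_diag !mxE mulrAC mulrC expr2.
Qed.

Lemma diag_conjugation_psd Q l : (forall i, 0 <= l 0 i) ->
  (Q *m diag_mx l *m Q^T) \in @psd_matrices R d.
Proof.
move=> l0; rewrite inE; split.
  by rewrite symmetricmxE !trmx_mul trmxK tr_diag_mx mulmxA.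
move=> v.
have -> : v^T *m (Q *m diag_mx l *m Q^T) *m v =
          (v^T *m Q) *m diag_mx l *m (v^T *m Q)^T.
  by rewrite trmx_mul trmxK !mulmxA.
rewrite diag_conjugation_entry sumr_ge0 // => k _.
by rewrite mulr_ge0 ?sqr_ge0.
Qed.

Lemma orthogonal_col_sqr Q k : Q *m Q^T = 1%:M -> \sum_i Q i k ^+ 2 = 1.
Proof.
move=> /mulmx1C /matrixP/(_ k k); rewrite !mxE eqxx mulr1n => <-.
by apply: eq_bigr => i _; rewrite !mxE expr2.
Qed.

Lemma sum_norm_diag_le_nuclear_norm A Q : A \is symmetricmx ->
  Q *m Q^T = 1%:M -> \sum_i `|(Q^T *m A *m Q) i i| <= nuclear_norm A.
Proof.
move=> /symmetric_diagonalization[P [a [PP ->]]] QQ.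
have TT : (Q^T *m P) *m (Q^T *m P)^T = 1%:M.
  by rewrite trmx_mul trmxK mulmxA -(mulmxA Q^T) PP mulmx1 mulmx1C.
rewrite nuclear_norm_diag //.
have -> : Q^T *m (P *m diag_mx a *m P^T) *m Q =
          (Q^T *m P) *m diag_mx a *m (Q^T *m P)^T.
  by rewrite trmx_mul trmxK !mulmxA.
(* Each [|a_k|] is spread over column [k] of the orthogonal matrix [Q^T *m P], whose squares sum to
   1; after exchanging the sums, the triangle inequality applies row by row. *)
under [leRHS]eq_bigr => k _ do
  rewrite -[`|_|]mulr1 -(orthogonal_col_sqr k TT) mulr_sumr.
rewrite exchange_big ler_sum //= => i _.
rewrite diag_conjugation_entry (le_trans (ler_norm_sum _ _ _)) // ler_sum // => k _.
by rewrite normrM (ger0_norm (sqr_ge0 _)).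
Qed.

(** Both norms depend only on the spectrum of [H], so any two canonical decompositions give the same
    values, whatever [Q] and [l] are. *)
Lemma canonical_nuclear_norms H Hp Hm : canonical_decomposition H Hp Hm ->
  nuclear_norm Hp = \sum_(x <- eigenvalues H) Num.max x 0 /\
  nuclear_norm Hm = \sum_(x <- eigenvalues H) Num.max (- x) 0.
Proof.
move=> [Q [l [QQ -> -> ->]]]; rewrite !nuclear_norm_diag // !sum_eigenvalues //.
by split; apply: eq_bigr => i _; rewrite mxE ger0_norm // le_max lexx orbT.
Qed.

Lemma nuclear_norm_eq0 H : H \is symmetricmx -> nuclear_norm H = 0 -> H = 0.
Proof.
move=> /symmetric_diagonalization[Q [l [QQ ->]]]; rewrite nuclear_norm_diag //.
move=> /eqP; rewrite psumr_eq0 // => /allP l0.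
suff -> : l = 0 by rewrite raddf0 mulmx0 mul0mx.
apply/rowP => i; rewrite mxE; apply/eqP.
by have := l0 i; rewrite mem_index_enum normr_eq0; apply.
Qed.

Lemma nuclear_norm_distance_ge H Hp Hm M : canonical_decomposition H Hp Hm ->
  M \in @psd_matrices R d -> nuclear_norm Hm <= nuclear_norm (H - M).
Proof.
move=> [Q [l [QQ HE _ ->]]]; rewrite inE => -[Msym Mpsd].
have As : H - M \is symmetricmx.
  move: Msym; rewrite !symmetricmxE HE linearB /= => /eqP ->.
  by rewrite !trmx_mul trmxK tr_diag_mx mulmxA.
apply: le_trans (sum_norm_diag_le_nuclear_norm As QQ).
rewrite nuclear_norm_diag // ler_sum // => i _.
have QtQ : Q^T *m Q = 1%:M by apply: mulmx1C.
have -> : Q^T *m (H - M) *m Q = diag_mx l - Q^T *m M *m Q.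
  by rewrite mulmxBr mulmxBl HE !mulmxA QtQ mul1mx -mulmxA QtQ mulmx1.
(* This entry is the quadratic form of [M] at the [i]-th column of [Q]. *)
have Mi : 0 <= (Q^T *m M *m Q) i i.
  have := Mpsd (col i Q).
  by rewrite tr_col -row_mul colE mulmxA -row_mul -colE 2!mxE.
move: (_ *m M *m Q) Mi => N Ni.
(* Since [N i i] is nonnegative, [- l 0 i <= N i i - l 0 i <= |l 0 i - N i i|]. *)
rewrite !mxE eqxx mulr1n ger0_norm ?le_max ?lexx ?orbT // ge_max normr_ge0 andbT.
by rewrite -normrN (le_trans _ (ler_norm _)) // opprB lerDr.
Qed.

Lemma nuclear_norm_distance_positive_part H Hp Hm :
  canonical_decomposition H Hp Hm ->
  Hp \in @psd_matrices R d /\ nuclear_norm (H - Hp) = nuclear_norm Hm.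
Proof.
move=> [Q [l [QQ -> -> ->]]]; split.
  by apply: diag_conjugation_psd => i; rewrite mxE le_max lexx orbT.
(* [H] and [Hp] share the eigenbasis [Q], so the claim reduces to [|x - max x 0| = max (- x) 0] for
   each eigenvalue [x]. *)
rewrite -mulmxBl -mulmxBr -raddfB !nuclear_norm_diag //.
apply: eq_bigr => i _; rewrite !mxE.
have [l0|l0] := lerP (l 0 i) 0.
  by rewrite subr0 max_l ?oppr_ge0 // normrN.
by rewrite subrr max_r // oppr_le0 ltW.
Qed.

End OrthogonalConjugation.

Theorem theorem3p1 (R : realType) (d : nat) (H Hp Hm : 'M[R]_d)
    (Hsym : H \is symmetricmx) (HD : canonical_decomposition H Hp Hm) :
  inf [set nuclear_norm (H - M) | M in @psd_matrices R d] = nuclear_norm Hm /\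
  LOPS H = nuclear_norm Hm /\
  (H != 0 ->
    [/\ nuclear_norm H != 0,
        NLOPS H = nuclear_norm Hm / nuclear_norm H &
        PS H = nuclear_norm Hp / nuclear_norm H]).
Proof.
have [Ep Em] := canonical_nuclear_norms HD.
have [Ep' Em'] := canonical_nuclear_norms (canonical_decomposition_exists Hsym).
split; last split; first last.
- by move=> H0; rewrite /NLOPS /PS Ep Em Ep' Em'; split=> //;
    apply: contra_neq H0; exact: nuclear_norm_eq0.
- by rewrite /LOPS Em Em'.
have [Hpsd Hdist] := nuclear_norm_distance_positive_part HD.
have Hlb : lbound [set nuclear_norm (H - M) | M in @psd_matrices R d]
                  (nuclear_norm Hm).
  by move=> _ [M MP <-]; apply: nuclear_norm_distance_ge HD _; rewrite inE.
have Hin : [set nuclear_norm (H - M) | M in @psd_matrices R d] (nuclear_norm Hm).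
  by exists Hp => //; rewrite inE in Hpsd.
(* The bound is attained at [Hp]: [Hlb] also supplies the boundedness and [Hin] the nonemptiness
   that the real infimum requires. *)
apply/eqP; rewrite eq_le; apply/andP; split.
  by apply: ge_inf => //; exists (nuclear_norm Hm).
by apply: lb_le_inf => //; exists (nuclear_norm Hm).
Qed.
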